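(* Let $K$ be a field. Let $T$ be a finite forest and let $v$ be a vertex of $T$ whose neighbours are $v_1,\dots,v_n$, where $n\geq 2$ and $v_1,\dots,v_{n-1}$ have degree one in $T$. Let $T'$ be the subgraph of $T$ obtained by deleting the vertex $v_1$, and let $T''$ be the subgraph of $T$ obtained by deleting the vertices $v,v_1,\dots,v_n$. Then for all $i$ and $d$, \[ \beta_{i,d}(T)=\beta_{i,d}(T')+\sum_{j=0}^{n-1}\binom{n-1}{j}\,\beta_{i-(j+1),\,d-(j+2)}(T''). \]
   Context: All graphs are finite and simple; a forest is a graph with no cycles. The degree of a vertex is its number of neighbours. Deleting a set of vertices from a graph means also deleting all edges incident to them. For a graph $G$ with vertex set $V(G)$ and edge set $E(G)$, let $K[V(G)]$ be the polynomial ring over the field $K$ whose variables are the vertices of $G$, and let $I(G)$ be the ideal generated by the monomials $uv$ with $\{u,v\}\in E(G)$. The numbers $\beta_{i,d}(G)$ are the graded Betti numbers of $K[V(G)]/I(G)$ over $K[V(G)]$ (standard grading): the $i$th module of the graded minimal free resolution is $\bigoplus_d K[V(G)](-d)^{\beta_{i,d}(G)}$. Thus $\beta_{0,d}(G)=\delta_{d,0}$ (Kronecker's delta), and $\beta_{i,d}(G)=0$ for $i<0$ by convention; also $\beta_{i,d}(G)=0$ for $d<0$. The graph with no vertices is allowed; its ring is $K$, so its only nonzero Betti number is $\beta_{0,0}=1$. *)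

(* Defs.v *)
From mathcomp Require Import all_boot all_order all_algebra.
From mathcomp Require Import mpoly.
From Stdlib Require Import ClassicalEpsilon.

Set Implicit Arguments.
Unset Strict Implicit.
Unset Printing Implicit Defensive.

Import GRing.Theory.

Record sgraph := SGraph {
  vertex :> finType;
  adj : rel vertex;
  adj_sym : ssrbool.symmetric adj;
  adj_irrefl : irreflexive adj
}.

Definition neighbours (G : sgraph) (x : G) : {set G} := [set y | adj x y].

Definition degree (G : sgraph) (x : G) : nat := #|neighbours x|.

(* A duplicate-free closed walk of length 2 traverses one edge back and forth
   and is not a cycle, whence the bound on the size. *)
Definition forest (G : sgraph) : Prop :=
  forall c : seq G, 2 < size c -> ~ ucycle (@adj G) c.

Section Delete.
Variables (G : sgraph) (A : {set G}).

Definition del_vertex : finType := {x : G | x \notin A}.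
Definition del_adj : rel del_vertex := [rel x y | adj (val x) (val y)].

Fact del_adj_sym : ssrbool.symmetric del_adj.
Proof. by move=> x y; exact: adj_sym. Qed.

Fact del_adj_irrefl : irreflexive del_adj.
Proof. by move=> x; exact: adj_irrefl. Qed.

Definition delete : sgraph := SGraph del_adj_sym del_adj_irrefl.
End Delete.

Local Open Scope ring_scope.

(* K[V(G)]: the variable of the vertex x is 'X_(enum_rank x). *)
Definition vvar (K : fieldType) (G : sgraph) (x : G) : {mpoly K[#|G|]} :=
  'X_(enum_rank x).

Definition edge_ideal (K : fieldType) (G : sgraph)
    (p : {mpoly K[#|G|]}) : Prop :=
  exists g : G -> G -> {mpoly K[#|G|]},
    p = \sum_(x : G) \sum_(y | adj x y) g x y * (vvar K x * vvar K y).

(* A graded minimal free resolution of S / I(G), where S = K[V(G)]: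
     ... -> F_2 -> F_1 -> F_0 -> S / I(G) -> 0.
   F_i has a basis indexed by 'I_(rk i), the k-th element of which has degree
   gdeg k, i.e., F_i is the direct sum of the S(- gdeg k).  Elements of F_i are
   row vectors and maps act by multiplication on the right.  The map
   F_0 -> S / I(G) is given by a homogeneous lift aug : F_0 -> S. *)
Record min_resolution (K : fieldType) (G : sgraph) := MinResolution {
  rk : nat -> nat;
  gdeg : forall i, 'I_(rk i) -> int;
  aug : 'cV[{mpoly K[#|G|]}]_(rk 0);
  bdry : forall i, 'M[{mpoly K[#|G|]}]_(rk i.+1, rk i);
  aug_homog : forall (k : 'I_(rk 0)) m,
    m \in msupp (aug k 0) -> gdeg k = (mdeg m)%:Z;
  bdry_homog : forall i (k : 'I_(rk i.+1)) (l : 'I_(rk i)) m,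
    m \in msupp (bdry i k l) -> gdeg k = gdeg l + (mdeg m)%:Z;
  aug_surj : exists u : 'rV_(rk 0), edge_ideal (1 - (u *m aug) 0 0);
  aug_exact : forall u : 'rV_(rk 0),
    edge_ideal ((u *m aug) 0 0) <-> exists w, u = w *m bdry 0;
  bdry_exact : forall i (u : 'rV_(rk i.+1)),
    u *m bdry i = 0 <-> exists w, u = w *m bdry i.+1;
  (* the image of F_(i+1) lies in m F_i, m the ideal of the variables *)
  bdry_min : forall i (k : 'I_(rk i.+1)) (l : 'I_(rk i)),
    (bdry i k l)@_0%MM = 0
}.

Definition betti_table (K : fieldType) (G : sgraph)
    (b : nat -> int -> nat) : Prop :=
  exists F : min_resolution K G,
    forall i d, b i d = #|[set k : 'I_(rk F i) | gdeg k == d]|.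

(* Minimal resolutions exist and are unique up to isomorphism, so exactly one
   table satisfies betti_table K G, and epsilon selects it. *)
Definition betti (K : fieldType) (G : sgraph) (i d : int) : nat :=
  match i with
  | Posz p => epsilon (inhabits (fun _ _ => 0%N)) (@betti_table K G) p d
  | Negz _ => 0%N
  end.

(* Main.v *)
Require Import Defs.
From HB Require Import structures.
From mathcomp Require Import all_boot all_order all_algebra.
From mathcomp Require Import mpoly ring.
From Stdlib Require Import ClassicalEpsilon.

Set Implicit Arguments.
Unset Strict Implicit.
Unset Printing Implicit Defensive.

Import GRing.Theory.

(** Let u be a leaf of a graph G, v its only neighbour, and let N(v) have m + 1
elements.  The Betti numbers of G are those of G - u plus those of
G - v - N(v) convolved with the binomial coefficients C(m, j) and shifted.
The theorem is the case u = v_1 and m = n - 1.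

Work over the ring S of all vertices of G and let I be the edge ideal of
G - u, extended to S.  Adding the generator u v to I gives the edge ideal of G,
and there is an exact sequence

  0 -> S/(I : u v)(-2) -> S/I -> S/I(G) -> 0

whose first map is the multiplication by u v.  The variable u does not occur in
I, so I : u v = I : v = J, where J is generated by the vertices of N(v) other
than u and by the edges of G that avoid v and N(v).

Minimal resolutions of S/I and S/J give one of S/I(G) by the mapping cone
([cone]).  The multiplication by v lifts to a map f of resolutions
([comparison]), so u f lifts the multiplication by u v; as all entries of u f
lie in the ideal of the variables, the cone is minimal, and the Betti numbers
just add up.  The same cone, with the multiplication by a variable x that is
regular on S/D, resolves S/(D + (x)); m such steps lead from the edges that
avoid v and N(v) to J and produce the binomial coefficients
([koszul_has_betti], [int_table_koszul]).

All ideals here are spanned by monomials, so that the colon ideals reduce to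
statements on exponents ([mono_cone_has_betti]).  Resolutions over the smaller
rings of G - u and of G - v - N(v) pass to S because S is free over the smaller
ring ([ext_has_betti]).  This gives the recursion in the form: tables of G - u
and of G - v - N(v) yield one of G ([leaf_betti_table]).

Betti numbers are well defined because two lifts of the identity in opposite
directions compose to a map homotopic to the identity, hence equal to it modulo
the variables ([mres_betti_leq]).  For a forest a table exists by induction
along the recursion, as a forest with an edge has a leaf
([forest_betti_table]). *)

(** * Homogeneous polynomials and matrices *)

Section Homogeneous.
Local Open Scope ring_scope.
Variables (K : fieldType) (n : nat).
Implicit Types (p q : {mpoly K[n]}) (d e : int).

(** Degrees are integers, not naturals, because entries of matrices have the
difference of two degrees as their degree; zero is homogeneous of every
degree, and the only polynomial homogeneous of a negative one. *)
Definition homogz d p := forall m, m \in msupp p -> (mdeg m)%:Z = d.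

Definition hpart d p : {mpoly K[n]} :=
  \sum_(m <- msupp p | (mdeg m)%:Z == d) p@_m *: 'X_[m].

Lemma mcoeff_hpart d p m :
  (hpart d p)@_m = if (mdeg m)%:Z == d then p@_m else 0.
Proof.
rewrite /hpart raddf_sum /=.
under eq_bigr => i _ do rewrite mcoeffZ mcoeffX.
have [mp|mp] := boolP (m \in msupp p).
  rewrite big_mkcond (bigD1_seq m) ?msupp_uniq //= eqxx mulr1.
  by rewrite big1 ?addr0 // => i /negbTE->; rewrite mulr0 if_same.
rewrite big1_seq => [|i /andP[_ ip]].
  by rewrite (memN_msupp_eq0 mp) if_same.
by case: eqP => [im|]; [rewrite -im ip in mp | rewrite mulr0].
Qed.

Lemma homogz_hpart d p : homogz d (hpart d p).
Proof.
move=> m; rewrite mcoeff_msupp mcoeff_hpart.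
by case: ifP => [/eqP //|]; rewrite eqxx.
Qed.

Lemma homogz_coeff d p m : homogz d p -> (mdeg m)%:Z != d -> p@_m = 0.
Proof.
move=> hp md; apply: memN_msupp_eq0; apply/negP => /hp mde.
by rewrite mde eqxx in md.
Qed.

Lemma hpart_id d p : homogz d p -> hpart d p = p.
Proof.
move=> hp; apply/mpolyP => m; rewrite mcoeff_hpart; case: ifPn => // md.
by rewrite (homogz_coeff hp md).
Qed.

Lemma homogz0 d : homogz d 0.
Proof. by move=> m; rewrite msupp0. Qed.

Lemma homogz_mpolyX m : homogz (mdeg m)%:Z ('X_[m] : {mpoly K[n]}).
Proof. by move=> e; rewrite msuppX inE => /eqP->. Qed.

Lemma homogzC (c : K) : homogz 0 c%:MP.
Proof.
move=> m; rewrite msuppC; case: ifP => // _.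
by rewrite inE => /eqP->; rewrite mdeg0.
Qed.

Lemma homogzD d p q : homogz d p -> homogz d q -> homogz d (p + q).
Proof. by move=> hp hq m /msuppD_le; rewrite mem_cat => /orP[/hp|/hq]. Qed.

Lemma homogz_opp d p : homogz d p -> homogz d (- p).
Proof. by move=> hp m; rewrite (perm_mem (msuppN _)) => /hp. Qed.

Lemma homogzM d e p q : homogz d p -> homogz e q -> homogz (d + e) (p * q).
Proof.
move=> hp hq m /msuppM_le /allpairsP[[m1 m2] /= [/hp <- /hq <- ->]].
by rewrite mdegD.
Qed.

Lemma hpart_is_additive d : additive (hpart d).
Proof.
move=> p q; apply/mpolyP => m; rewrite mcoeffB !mcoeff_hpart mcoeffB.
by case: ifP => // _; rewrite subr0.
Qed.

HB.instance Definition _ d :=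
  GRing.isAdditive.Build {mpoly K[n]} {mpoly K[n]} (hpart d)
    (hpart_is_additive d).

(** Homogeneous parts commute with multiplication by homogeneous polynomials:
this is what allows to replace a solution of a homogeneous linear system by a
homogeneous solution. *)
Lemma hpartMr d e p q : homogz e q -> hpart (d + e) (p * q) = hpart d p * q.
Proof.
move=> hq; apply/mpolyP => m; rewrite mcoeff_hpart !mcoeffM.
case: ifPn => md; last first.
  rewrite big1 // => k /eqP mk; rewrite mcoeff_hpart.
  case: eqP => [kd|_]; last by rewrite mul0r.
  rewrite (homogz_coeff hq) ?mulr0 //; apply: contraNneq md => ke.
  by rewrite (congr1 mdeg mk) mdegD PoszD kd ke.
apply: eq_bigr => k /eqP mk; rewrite mcoeff_hpart.
case: ifPn => // kd; rewrite (homogz_coeff hq) ?mulr0 //.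
apply: contraNneq kd => ke.
have := congr1 mdeg mk; rewrite mdegD => mE; move: md.
by rewrite {1}mE PoszD ke (inj_eq (addIr e)).
Qed.

End Homogeneous.

Section HomogeneousMatrices.
Local Open Scope ring_scope.
Variables (K : fieldType) (n : nat).
Local Notation S := {mpoly K[n]}.

(** The condition that the matrix of a map between graded free modules, with
bases in degrees a and b, preserves degrees. *)
Definition homogmx r s (a : 'I_r -> int) (b : 'I_s -> int) (M : 'M[S]_(r, s)) :=
  forall k l, homogz (a k - b l) (M k l).

Definition hpartmx r s (a : 'I_r -> int) (b : 'I_s -> int) (M : 'M[S]_(r, s)) :=
  \matrix_(k, l) hpart (a k - b l) (M k l).

Lemma homogmx_hpartmx r s a b (M : 'M[S]_(r, s)) : homogmx a b (hpartmx a b M).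
Proof. by move=> k l; rewrite mxE; apply: homogz_hpart. Qed.

Lemma hpartmx_id r s a b (M : 'M[S]_(r, s)) :
  homogmx a b M -> hpartmx a b M = M.
Proof. by move=> hM; apply/matrixP => k l; rewrite mxE hpart_id. Qed.

Lemma hpartmxM r s t a b c (M : 'M[S]_(r, s)) (N : 'M[S]_(s, t)) :
  homogmx b c N -> hpartmx a c (M *m N) = hpartmx a b M *m N.
Proof.
move=> hN; apply/matrixP => k l; rewrite !mxE raddf_sum /=.
apply: eq_bigr => j _; rewrite mxE -(hpartMr _ _ (hN j l)).
by rewrite addrA subrK.
Qed.

Lemma homogmxM r s t a b c (M : 'M[S]_(r, s)) (N : 'M[S]_(s, t)) :
  homogmx a b M -> homogmx b c N -> homogmx a c (M *m N).
Proof.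
move=> hM hN; rewrite -(hpartmx_id hM) -(hpartmxM _ _ hN).
exact: homogmx_hpartmx.
Qed.

End HomogeneousMatrices.

(** * Minimal resolutions and uniqueness of their Betti numbers *)
Section Resolutions.
Local Open Scope ring_scope.
Variables (K : fieldType) (n : nat).
Local Notation S := {mpoly K[n]}.

Record homog_ideal (I : S -> Prop) : Prop := HomogIdeal {
  ideal0 : I 0;
  idealD : forall p q, I p -> I q -> I (p + q);
  idealMl : forall a p, I p -> I (a * p);
  ideal_hpart : forall d p, I p -> I (hpart d p)
}.

Lemma idealN I p : homog_ideal I -> I p -> I (- p).
Proof. by move=> hI; rewrite -mulN1r; apply: idealMl. Qed.

Lemma idealB I p q : homog_ideal I -> I p -> I q -> I (p - q).
Proof. by move=> hI Ip Iq; apply: idealD => //; apply: idealN. Qed.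

Lemma ideal_sum I (T : Type) (r : seq T) (P : pred T) (F : T -> S) :
  homog_ideal I -> (forall t, P t -> I (F t)) -> I (\sum_(t <- r | P t) F t).
Proof.
move=> hI IF; elim/big_ind: _ => //; first exact: ideal0.
by move=> p q; apply: idealD.
Qed.

Lemma ideal_mulmx I r s t (M : 'M[S]_(r, s)) (N : 'M[S]_(s, t)) k l :
  homog_ideal I -> (forall j, I (N j l)) -> I ((M *m N) k l).
Proof.
by move=> hI IN; rewrite mxE; apply: ideal_sum => // j _; apply: idealMl.
Qed.

(** The reduction modulo the ideal of the variables. *)
Definition redmx r s (M : 'M[S]_(r, s)) : 'M[K]_(r, s) :=
  map_mx (mcoeff 0%MM) M.

Lemma redmxM r s t (M : 'M[S]_(r, s)) (N : 'M[S]_(s, t)) :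
  redmx (M *m N) = redmx M *m redmx N.
Proof. exact: map_mxM. Qed.

(** The fields are those of a minimal resolution of a graph, for the quotient by
an arbitrary I: the recursion passes through ideals generated by edges and
variables, over rings that have more variables than the graph has vertices. *)
Record minres (I : S -> Prop) := MinRes {
  mrk : nat -> nat;
  mdg : forall i, 'I_(mrk i) -> int;
  maug : 'cV[S]_(mrk 0);
  md : forall i, 'M[S]_(mrk i.+1, mrk i);
  maug_homog : homogmx (@mdg 0) (fun=> 0) maug;
  md_homog : forall i, homogmx (@mdg i.+1) (@mdg i) (md i);
  maug_surj : exists u : 'rV_(mrk 0), I (1 - (u *m maug) 0 0);
  maug_exact : forall u : 'rV_(mrk 0),
    I ((u *m maug) 0 0) <-> exists w, u = w *m md 0;
  md_exact : forall i (u : 'rV_(mrk i.+1)),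
    u *m md i = 0 <-> exists w, u = w *m md i.+1;
  md_min : forall i, redmx (md i) = 0
}.

Arguments maug_homog {I} m k l m0 _ : rename.
Arguments md_homog {I} m i k l m0 _ : rename.
Arguments maug_surj {I} m.

(** The kernel of the map out of the i-th module, where the map out of the 0-th
one goes to S / I: this puts the augmentation on the same footing as the
other maps. *)
Definition mker I (F : minres I) i : 'rV[S]_(mrk F i) -> Prop :=
  match i with
  | 0 => fun u => I ((u *m maug F) 0 0)
  | j.+1 => fun u => u *m md F j = 0
  end.

Lemma mker_exact I (F : minres I) i (u : 'rV_(mrk F i)) :
  mker u <-> exists w, u = w *m md F i.
Proof. by case: i u => [|i] u; [apply: maug_exact | apply: md_exact]. Qed.

Lemma mker_rows I (F : minres I) i r (M : 'M_(r, mrk F i)) :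
  (forall k, mker (row k M)) -> exists W, M = W *m md F i.
Proof.
move=> hM; have /fin_all_exists[w hw] k : exists w, row k M = w *m md F i.
  exact/mker_exact.
exists (\matrix_k w k); apply/row_matrixP => k.
by rewrite hw row_mul rowK.
Qed.

Lemma md_md I (F : minres I) i : md F i.+1 *m md F i = 0.
Proof.
apply/row_matrixP => k; rewrite row_mul row0.
by apply/md_exact; exists (delta_mx 0 k); rewrite rowE.
Qed.

Lemma maug_d I (F : minres I) k : I ((md F 0 *m maug F) k 0).
Proof.
have: mker (row k (md F 0)).
  by apply/mker_exact; exists (delta_mx 0 k); rewrite rowE.
by rewrite /= -row_mul mxE.
Qed.

Lemma dependent_choice (A : nat -> Type) (P : forall i, A i -> Prop)
    (R : forall i, A i -> A i.+1 -> Prop) (a0 : A 0) :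
  P 0 a0 -> (forall i a, P i a -> exists a', P i.+1 a' /\ R i a a') ->
  exists f : forall i, A i,
    [/\ f 0 = a0, forall i, P i (f i) & forall i, R i (f i) (f i.+1)].
Proof.
move=> Pa0 step.
pose next i (s : {a : A i | P i a}) :=
  constructive_indefinite_description _ (step i (sval s) (svalP s)).
pose f := nat_rect (fun i => {a : A i | P i a}) (exist _ a0 Pa0)
  (fun i s => exist _ (sval (next i s)) (proj1 (svalP (next i s)))).
exists (fun i => sval (f i)); split=> // i; first exact: svalP.
exact: (proj2 (svalP (next i (f i)))).
Qed.

(** The comparison theorem for the multiplication by p, from S / J to S / I.
Each step lifts along an exact row and then keeps the homogeneous part. *)
Lemma comparison I J (F : minres I) (G : minres J) p e :
    homog_ideal I -> homogz e p -> (forall g, J g -> I (p * g)) ->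
  exists f : forall i, 'M[S]_(mrk G i, mrk F i),
    [/\ forall k, I ((f 0 *m maug F - p *: maug G) k 0),
        forall i, f i.+1 *m md F i = md G i *m f i
      & forall i, homogmx (fun k => mdg k + e) (@mdg _ _ i) (f i)].
Proof.
move=> hI hp pJ; have [u Iu] := maug_surj F.
pose M0 := p *: (maug G *m u).
pose f0 := hpartmx (fun k => mdg k + e) (@mdg _ F 0) M0.
have f0aug k : I ((f0 *m maug F - p *: maug G) k 0).
  have hpG : homogmx (fun k => mdg k + e) (fun=> 0) (p *: maug G).
    move=> k' l; rewrite mxE [_ - 0](_ : _ = e + (mdg k' - 0)); last first.
      by rewrite !subr0 addrC.
    by apply: homogzM => //; apply: maug_homog.
  rewrite -(hpartmxM _ _ (maug_homog F)) -[X in _ - X](hpartmx_id hpG).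
  have -> : M0 *m maug F = p * (u *m maug F) 0 0 *: maug G.
    rewrite /M0 -scalemxAl -mulmxA {1}[u *m _]mx11_scalar.
    by rewrite mul_mx_scalar scalerA.
  set c := (u *m maug F) 0 0 in Iu *; clearbody c.
  rewrite !mxE -raddfB /=; apply: ideal_hpart => //.
  rewrite (_ : _ - _ = - (p * maug G k 0) * (1 - c)); first exact: idealMl.
  by rewrite mulNr mulrBr mulr1 opprB mulrAC.
pose P i (f : 'M_(mrk G i, mrk F i)) :=
  (forall u : 'rV_(mrk G i), mker u -> mker (u *m f))
  /\ homogmx (fun k => mdg k + e) (@mdg _ _ i) f.
pose R i (f : 'M_(mrk G i, mrk F i)) (g : 'M_(mrk G i.+1, mrk F i.+1)) :=
  g *m md F i = md G i *m f.
have [|i f [kerf hf]|f [f0E Pf Rf]] := @dependent_choice _ P R f0.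
- split=> [w /= Jw|]; last exact: homogmx_hpartmx.
  rewrite -mulmxA -[f0 *m _](subrK (p *: maug G)) mulmxDr mxE.
  apply: idealD => //; first by apply: ideal_mulmx => // j; apply: f0aug.
  by rewrite -scalemxAr mxE; apply: pJ.
- have /mker_rows[W WE] : forall k, mker (row k (md G i *m f)).
    move=> k; rewrite row_mul; apply: kerf; apply/mker_exact.
    by exists (delta_mx 0 k); rewrite rowE.
  pose g := hpartmx (fun k => mdg k + e) (@mdg _ F i.+1) W.
  have gE : g *m md F i = md G i *m f.
    rewrite -(hpartmxM _ _ (md_homog F i)) -WE hpartmx_id //.
    apply: homogmxM hf => k l; rewrite opprD addrACA subrr addr0.
    exact: md_homog.
  exists g; split=> //; split; last exact: homogmx_hpartmx.
  by move=> w /= w0; rewrite -mulmxA gE mulmxA w0 mul0mx.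
exists f; split=> [|//|i]; first by rewrite f0E.
exact: (Pf i).2.
Qed.

(** An endomorphism h of F that lifts zero is homotopic to zero, that is,
h = s d + d s, and d vanishes modulo the variables.  The homotopy is built one
step at a time; all that a step must know of the previous one is that the
remainder h - s d is killed by d and vanishes modulo the variables. *)
Lemma null_homotopic_min I (F : minres I) (h : forall i, 'M[S]_(mrk F i)) :
    (forall k, I ((h 0 *m maug F) k 0)) ->
    (forall i, h i.+1 *m md F i = md F i *m h i) ->
  forall i, redmx (h i) = 0.
Proof.
move=> h0 hS i.
suff [s [dhs red]] : exists s, md F i *m (h i - s *m md F i) = 0
    /\ redmx (h i - s *m md F i) = 0.
  rewrite -[h i](subrK (s *m md F i)) /redmx map_mxD.
  by rewrite -/(redmx _) red add0r map_mxM /= -/(redmx (md F i)) md_min mulmx0.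
elim: i => [|i [s [dhs red]]].
  have /mker_rows[s ->] : forall k, mker (row k (h 0)).
    by move=> k /=; rewrite -row_mul mxE.
  by exists s; rewrite subrr mulmx0 /redmx map_mx0.
have /mker_rows[t tE] : forall k, mker (row k (h i.+1 - md F i *m s)).
  move=> k /=; rewrite -row_mul mulmxBl hS -mulmxA -mulmxBr dhs.
  exact: row0.
exists t; rewrite -tE opprB addrCA subrr addr0 mulmxA md_md mul0mx.
by rewrite redmxM md_min mul0mx.
Qed.

(** A respects degrees, so that in A B = 1 the rows of degree d only meet
columns of A of degree d: the submatrix of A on these still has a right
inverse. *)
Lemma graded_right_inverse_leq r s (a : 'I_r -> int) (b : 'I_s -> int)
    (A : 'M[K]_(r, s)) (B : 'M[K]_(s, r)) d :
    (forall k l, A k l != 0 -> a k = b l) -> A *m B = 1%:M ->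
  (#|[set k | a k == d]| <= #|[set l | b l == d]|)%N.
Proof.
move=> hA AB.
pose f := @enum_val _ (mem [set k | a k == d]).
pose g := @enum_val _ (mem [set l | b l == d]).
apply: (@mulmx1_min _ _ _ (mxsub f g A) (mxsub g f B)).
apply/matrixP => i j; rewrite !mxE -(inj_eq enum_val_inj).
have /matrixP/(_ (f i) (f j)) := AB; rewrite !mxE => <-.
rewrite (bigID [pred l | b l == d]) /= [X in _ = _ + X]big1 ?addr0; last first.
  move=> l bl; have [->|/hA fl] := eqVneq (A (f i) l) 0; first by rewrite mul0r.
  by have := enum_valP i; rewrite inE -/(f i) fl (negbTE bl).
rewrite [RHS](eq_bigl (mem [set l | b l == d])); last first.
  by move=> l; rewrite /= inE.
rewrite [RHS]big_enum_val /=.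
by apply: eq_bigr => l _; rewrite !mxE.
Qed.

Definition mres_betti I (F : minres I) i (d : int) : nat :=
  #|[set k : 'I_(mrk F i) | mdg k == d]|.

(** A lift F -> G of the identity that preserves degrees, followed by a lift
G -> F, is homotopic to the identity of F, hence equal to it modulo the
variables. *)
Lemma mres_betti_leq I (F G : minres I) i d :
  homog_ideal I -> (mres_betti F i d <= mres_betti G i d)%N.
Proof.
move=> hI.
have hI1 g : I g -> I (1 * g) by rewrite mul1r.
have h1 : homogz 0 (1 : S) by exact: homogzC.
have [f [f0 fS hf]] := comparison G F hI h1 hI1.
have [g [g0 gS _]] := comparison F G hI h1 hI1.
have fg1 j : redmx (f j *m g j - 1%:M) = 0.
  move: j; apply: null_homotopic_min => [k|j]; last first.
    by rewrite mulmxBl mulmxBr mul1mx mulmx1 -mulmxA gS !mulmxA fS.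
  rewrite mulmxBl mul1mx -mulmxA.
  rewrite -[g 0 *m _](subrK (1 *: maug G)) mulmxDr scale1r -addrA mxE.
  apply: idealD => //; last by have := f0 k; rewrite scale1r.
  by apply: ideal_mulmx => // l; have := g0 l; rewrite scale1r.
apply: (@graded_right_inverse_leq _ _ _ _ (redmx (f i)) (redmx (g i))).
  move=> k l; rewrite mxE -mcoeff_msupp => /hf; rewrite mdeg0 addr0.
  by move/esym/eqP; rewrite subr_eq0 => /eqP.
have := fg1 i; rewrite /redmx map_mxB map_mxM /= map_mx1 => /eqP.
by rewrite subr_eq0 => /eqP.
Qed.

End Resolutions.

Arguments maug_homog {K n I} m k l m0 _ : rename.
Arguments md_homog {K n I} m i k l m0 _ : rename.
Arguments maug_surj {K n I} m.

(** * The mapping cone *)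
Section Cone.
Local Open Scope ring_scope.
Variables (K : fieldType) (n : nat).
Local Notation S := {mpoly K[n]}.
Variables (I J : S -> Prop) (F : minres I) (G : minres J).
Variables (y p : S) (a e : int).
Hypotheses (hI : homog_ideal I) (ya : homogz a y) (y0 : y@_0%MM = 0).
Hypothesis yreg : forall g, I (y * g) -> I g.
Hypothesis colon : forall g, I (p * g) <-> J g.
Variable f : forall i, 'M[S]_(mrk G i, mrk F i).
Hypothesis f_aug : forall k, I ((f 0 *m maug F - p *: maug G) k 0).
Hypothesis f_md : forall i, f i.+1 *m md F i = md G i *m f i.
Hypothesis f_homog :
  forall i, homogmx (fun k => mdg k + e) (@mdg _ _ _ F i) (f i).

(** The ideal I + (y p). *)
Definition cone_ideal g := exists s, I (g - y * p * s).

(** The connecting map of the cone.  It anticommutes with the differentials, so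
that these square to zero, and the factor y makes it vanish modulo the
variables. *)
Definition cone_map i : 'M[S]_(mrk G i, mrk F i) := ((-1) ^+ i * y) *: f i.

Definition cone_rk i : nat :=
  match i with 0 => mrk F 0 | j.+1 => (mrk F j.+1 + mrk G j)%N end.

Definition cone_dg i : 'I_(cone_rk i) -> int :=
  match i with
  | 0 => @mdg _ _ _ F 0
  | j.+1 => fun k => match split k with
                     | inl k1 => mdg k1
                     | inr k2 => mdg k2 + (a + e)
                     end
  end.

Definition cone_md i : 'M[S]_(cone_rk i.+1, cone_rk i) :=
  match i with
  | 0 => col_mx (md F 0) (cone_map 0)
  | j.+1 => block_mx (md F j.+1) 0 (cone_map j.+1) (md G j)
  end.

Lemma cone_map_md i : cone_map i.+1 *m md F i = - (md G i *m cone_map i).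
Proof.
rewrite /cone_map -scalemxAl f_md scalemxAr exprS.
by rewrite mulN1r mulNr scaleNr mulmxN.
Qed.

Lemma cone_map_homog i :
  homogmx (fun k => mdg k + (a + e)) (@mdg _ _ _ F i) (cone_map i).
Proof.
move=> k l; rewrite mxE addrCA -addrA.
apply: homogzM; last exact: f_homog.
rewrite -signr_odd; case: (odd i); rewrite ?mul1r // mulN1r.
exact: homogz_opp.
Qed.

Lemma cone_map_min i : redmx (cone_map i) = 0.
Proof.
by rewrite /redmx map_mxZ rmorphM /= y0 mulr0 scale0r.
Qed.

Lemma cone_md_homog i : homogmx (@cone_dg i.+1) (@cone_dg i) (cone_md i).
Proof.
case: i => [|i] k l; rewrite /= mxE; case: (split k) => k'.
- exact: md_homog.
- exact: cone_map_homog.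
- rewrite mxE; case: (split l) => l'; first exact: md_homog.
  by rewrite mxE; apply: homogz0.
- rewrite mxE; case: (split l) => l'; first exact: cone_map_homog.
  by rewrite opprD addrACA subrr addr0; apply: md_homog.
Qed.

Lemma cone_md_min i : redmx (cone_md i) = 0.
Proof.
have mF := md_min F; have mG := md_min G; have mf := cone_map_min.
case: i => [|i]; rewrite /redmx /=.
  rewrite map_col_mx -!/(redmx _) mF mf; exact: col_mx0.
by rewrite map_block_mx -!/(redmx _) mF mG mf /redmx map_mx0; exact: block_mx0.
Qed.

Lemma cone_map_aug (u : 'rV_(mrk G 0)) :
  I ((u *m cone_map 0 *m maug F) 0 0 - y * p * (u *m maug G) 0 0).
Proof.
rewrite /cone_map expr0 mul1r -scalemxAr -scalemxAl -mulmxA.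
rewrite -[f 0 *m _](subrK (p *: maug G)) mulmxDr -scalemxAr.
set w := u *m (_ - _); have Iw : I (w 0 0) by apply: ideal_mulmx.
move: w (u *m maug G) Iw => w v Iw.
by rewrite !mxE mulrDr mulrA addrK; apply: idealMl.
Qed.

Lemma cone_maug_surj :
  exists u : 'rV_(mrk F 0), cone_ideal (1 - (u *m maug F) 0 0).
Proof.
have [u Iu] := maug_surj F; exists u, 0.
by rewrite mulr0 subr0.
Qed.

(** If u maps to y p s modulo I, then s is the image modulo J of some s v with v
in G_0; subtracting the image of s v under the connecting map leaves an
element of the kernel I of the augmentation. *)
Lemma cone_maug_exact (u : 'rV_(mrk F 0)) :
  cone_ideal ((u *m maug F) 0 0) <-> exists w, u = w *m cone_md 0.
Proof.
split=> [[s Is]|[w ->]].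
  have [v Jv] := maug_surj G.
  have /mker_exact[w wE] : mker (u - s *: v *m cone_map 0).
    have := cone_map_aug (s *: v).
    rewrite -[s *: v *m maug G]scalemxAl [fun_of_matrix (s *: _) 0 0]mxE.
    rewrite /= mulmxBl [fun_of_matrix (_ - _) 0 0]mxE.
    rewrite [fun_of_matrix (- _) 0 0]mxE.
    have Iv := idealMl hI (y * s) ((colon _).2 Jv); move: Is Iv.
    set U := (u *m _) 0 0; set C := (_ *m maug F) 0 0; set V := (v *m _) 0 0.
    move=> Is Iv Ic; have := idealB hI (idealD hI Is Iv) Ic.
    by congr I; ring.
  exists (row_mx w (s *: v)).
  by rewrite mul_row_col -wE subrK.
rewrite /= -[w]hsubmxK mul_row_col mulmxDl.
exists ((rsubmx w *m maug G) 0 0).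
rewrite mxE -addrA; apply: idealD => //; last exact: cone_map_aug.
by rewrite -mulmxA; apply: ideal_mulmx => // j; apply: maug_d.
Qed.

(** The step common to exactness in the lowest degree and in the others, which
differ only in the reason why v is in the kernel. *)
Lemma cone_lift i (w : 'rV_(mrk F i.+1)) (v : 'rV_(mrk G i)) :
    w *m md F i + v *m cone_map i = 0 -> mker v ->
  exists t, row_mx w v = t *m cone_md i.+1.
Proof.
move=> wv /mker_exact[t tv].
have /mker_exact[s sE] : mker (w - t *m cone_map i.+1).
  by rewrite /= mulmxBl -mulmxA cone_map_md mulmxN opprK mulmxA -tv.
exists (row_mx s t); rewrite /= mul_row_block mulmx0 add0r -sE subrK -tv.
by [].
Qed.

Lemma cone_md_exact i (u : 'rV_(cone_rk i.+1)) :
  u *m cone_md i = 0 <-> exists w, u = w *m cone_md i.+1.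
Proof.
split=> [|[w ->]]; last first.
  rewrite -[w]hsubmxK /= mul_row_block mulmx0 add0r.
  case: i u w => [|i] u w.
    rewrite /= mul_row_col mulmxDl -!mulmxA md_md mulmx0 add0r cone_map_md.
    by rewrite mulmxN addNr.
  rewrite /= mul_row_block mulmx0 add0r mulmxDl -!mulmxA !md_md !mulmx0 add0r.
  by rewrite cone_map_md mulmxN addNr row_mx0.
rewrite -[u]hsubmxK; case: i u => [|i] u.
  rewrite /= mul_row_col => u0; apply: cone_lift => //=.
  apply/colon/yreg; rewrite mulrA.
  have := cone_map_aug (rsubmx u).
  rewrite -[_ *m cone_map 0](addKr (lsubmx u *m md F 0)) u0 addr0 mulNmx mxE.
  move=> Iy; rewrite -[y * p * _](subKr (- (lsubmx u *m md F 0 *m maug F) 0 0)).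
  apply: idealB => //; apply: idealN => //.
  by rewrite -mulmxA; apply: ideal_mulmx => // j; apply: maug_d.
rewrite /= mul_row_block mulmx0 add0r -[X in _ = X -> _]row_mx0.
by move=> /eq_row_mx[uw v0]; apply: cone_lift.
Qed.

Definition cone : minres cone_ideal :=
  @MinRes K n cone_ideal cone_rk cone_dg (maug F) cone_md (maug_homog F)
    cone_md_homog cone_maug_surj cone_maug_exact cone_md_exact cone_md_min.

Lemma cone_betti i d : mres_betti cone i d =
  (mres_betti F i d +
   if i is j.+1 then mres_betti G j (d - (a + e)) else 0)%N.
Proof.
rewrite /mres_betti; case: i => [|i]; first by rewrite addn0.
rewrite -!sum1dep_card big_split_ord /=; congr (_ + _)%N.
  by apply: eq_bigl => k; rewrite (unsplitK (inl k)).
apply: eq_bigl => k; rewrite (unsplitK (inr k)).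
by rewrite [RHS]eq_sym subr_eq eq_sym.
Qed.

End Cone.

(** * Tables of Betti numbers *)
Section BettiTables.
Local Open Scope ring_scope.
Variables (K : fieldType) (n : nat).
Local Notation S := {mpoly K[n]}.
Implicit Types (I J : S -> Prop) (b : nat -> int -> nat).

Definition has_betti I b :=
  exists F : minres I, forall i d, b i d = mres_betti F i d.

Lemma has_betti_uniq I b b' i d :
  homog_ideal I -> has_betti I b -> has_betti I b' -> b i d = b' i d.
Proof.
move=> hI [F bF] [G bG]; rewrite bF bG.
by apply/eqP; rewrite eqn_leq !mres_betti_leq.
Qed.

Lemma has_betti_iff I J b :
  (forall g, I g <-> J g) -> has_betti I b -> has_betti J b.
Proof.
move=> IJ [F bF]; have [u /IJ Ju] := maug_surj F.
have Jex (v : 'rV_(mrk F 0)) :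
    J ((v *m maug F) 0 0) <-> exists w, v = w *m md F 0.
  by split=> [/IJ Iv|hv]; [apply/maug_exact | apply/IJ/maug_exact].
by exists (@MinRes K n J (mrk F) (@mdg _ _ _ F) (maug F) (md F) (maug_homog F)
  (md_homog F) (ex_intro _ u Ju) Jex (@md_exact _ _ _ F) (@md_min _ _ _ F)).
Qed.

Definition shift_table (b : nat -> int -> nat) (c : int) (i : nat) (d : int) :=
  if i is j.+1 then b j (d - c) else 0%N.

Lemma cone_has_betti I J y p a e b b' :
    homog_ideal I -> homogz a y -> y@_0%MM = 0 -> homogz e p ->
    (forall g, I (y * g) -> I g) -> (forall g, I (p * g) <-> J g) ->
    has_betti I b -> has_betti J b' ->
  has_betti (cone_ideal I y p)
    (fun i d => b i d + shift_table b' (a + e) i d)%N.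
Proof.
move=> hI ya y0 pe yreg colon [F bF] [G bG].
have [f [f0 fS hf]] := comparison F G hI pe (fun g => (colon g).2).
exists (cone hI ya y0 yreg colon f0 fS hf) => i d.
by rewrite cone_betti bF; case: i => [|i] //=; rewrite bG.
Qed.

End BettiTables.

(** * Adjoining variables *)
Section BaseChange.
Local Open Scope ring_scope.

Lemma mpoly_rmorph_eq (R A : comNzRingType) n
    (f g : {rmorphism {mpoly R[n]} -> A}) :
  (forall c, f c%:MP = g c%:MP) -> (forall i, f 'X_i = g 'X_i) -> f =1 g.
Proof.
move=> fgC fgX p; rewrite [p]mpolyE !raddf_sum; apply: eq_bigr => m _.
rewrite /= -mul_mpolyC !rmorphM /= fgC; congr (_ * _).
rewrite mpolyXE_id !rmorph_prod; apply: eq_bigr => i _.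
by rewrite !rmorphXn /= fgX.
Qed.

(* The ring R becomes the subring of S on the variables in the image of s. *)
Variables (K : fieldType) (m n : nat) (s : 'I_m -> 'I_n).
Hypothesis s_inj : injective s.
Local Notation R := {mpoly K[m]}.
Local Notation S := {mpoly K[n]}.

Definition incl : R -> S := mmap (@mpolyC n K) (fun i => 'X_(s i)).
HB.instance Definition _ := GRing.RMorphism.on incl.

(** S is written as polynomials over R in the remaining variables.  All n
variables are kept, so that those in the image of s never occur; the
coefficients of this expansion are R-linear, and recover the polynomial. *)
Definition separate_var (j : 'I_n) : {mpoly R[n]} :=
  if [pick i | s i == j] is Some i then ('X_i)%:MP else 'X_j.

Definition separate : S -> {mpoly R[n]} :=
  mmap (@mpolyC n R \o @mpolyC m K) separate_var.
HB.instance Definition _ := GRing.RMorphism.on separate.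

Definition recombine : {mpoly R[n]} -> S := mmap incl (fun j => 'X_j).
HB.instance Definition _ := GRing.RMorphism.on recombine.

Definition proj (c : 'X_{1..n}) (g : S) : R := (separate g)@_c.
HB.instance Definition _ c :=
  GRing.Additive.copy (proj c) (mcoeff c \o separate).

Lemma inclC c : incl c%:MP = c%:MP. Proof. exact: mmapC. Qed.
Lemma inclX i : incl 'X_i = 'X_(s i).
Proof. by rewrite /incl mmapX mmap1U. Qed.

Lemma separate_incl r : separate (incl r) = r%:MP.
Proof.
apply: (@mpoly_rmorph_eq _ _ _ (separate \o incl) (@mpolyC n R)) => [c|i] /=.
  by rewrite inclC; apply: mmapC.
rewrite inclX /separate mmapX mmap1U /separate_var.
by case: pickP => [j /eqP/s_inj -> //|/(_ i)]; rewrite eqxx.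
Qed.

Lemma separateK : cancel separate recombine.
Proof.
apply: (@mpoly_rmorph_eq _ _ _ (recombine \o separate) idfun) => [c|i] /=.
  by rewrite /separate mmapC /= /recombine mmapC /= inclC.
rewrite /separate mmapX mmap1U /separate_var.
case: pickP => [j /eqP <-|_]; first by rewrite /recombine mmapC /= inclX.
by rewrite /recombine mmapX mmap1U.
Qed.

Lemma projM c r g : proj c (incl r * g) = r * proj c g.
Proof. by rewrite /proj rmorphM /= separate_incl mcoeffCM. Qed.

Lemma map_projM c a t l (M : 'M[S]_(a, t)) (N : 'M[R]_(t, l)) :
  map_mx (proj c) (M *m map_mx incl N) = map_mx (proj c) M *m N.
Proof.
apply/matrixP => i j; rewrite !mxE raddf_sum; apply: eq_bigr => k _ /=.
by rewrite !mxE mulrC projM mulrC.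
Qed.

Lemma sum_proj g k : (msize (separate g) <= k)%N ->
  g = \sum_(c : 'X_{1..n < k}) 'X_[c] * incl (proj c g).
Proof.
move=> gk; rewrite -{1}[g]separateK {1}(mpolywE gk) raddf_sum /=.
by apply: eq_bigr => c _; rewrite /recombine mmapZ mmapX mulrC mmap1_id.
Qed.

Lemma homogz_incl d (p : R) : homogz d p -> homogz d (incl p).
Proof.
move=> hp; rewrite /incl /mmap big_seq; elim/big_ind: _ => [||c /hp <-].
- exact: homogz0.
- exact: homogzD.
rewrite -[_%:Z]add0r; apply: homogzM; first exact: homogzC.
rewrite mdegE /mmap1; elim/big_rec2: _ => [|i q k _ hq]; first exact: homogzC.
rewrite PoszD mpolyXn; apply: homogzM => //.
by have := @homogz_mpolyX K n (U_(s i) *+ c i)%MM; rewrite mdegMn mdeg1 mul1n.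
Qed.

Lemma incl_coeff0 r : (incl r)@_0%MM = r@_0%MM.
Proof.
apply: (@mpoly_rmorph_eq _ _ _ (mcoeff 0%MM \o incl) (mcoeff 0%MM)) => [c|i] /=.
  by rewrite inclC !mcoeffC !eqxx.
by rewrite inclX !mcoeffX !mnm1_eq0.
Qed.

Definition ext_ideal (I : R -> Prop) (g : S) := forall c, I (proj c g).

(** Flatness: a system over R is solvable over S as soon as it is so for each
coefficient. *)
Lemma exact_incl r t (M : 'M[R]_(r, t)) (u : 'rV[S]_t) :
    (forall c, exists w, map_mx (proj c) u = w *m M) ->
  exists w, u = w *m map_mx incl M.
Proof.
move=> hu; pose k := \max_(j < t) msize (separate (u 0%R j)).
have /fin_all_exists[w hw] (c : 'X_{1..n < k}) := hu c.
exists (\sum_(c : 'X_{1..n < k}) 'X_[c] *: map_mx incl (w c)).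
apply/rowP => j; rewrite mulmx_suml summxE.
rewrite (@sum_proj (u 0 j) k); last exact: leq_bigmax.
apply: eq_bigr => c _; rewrite -scalemxAl -map_mxM -hw !mxE.
by [].
Qed.

Lemma ext_has_betti I b :
  homog_ideal I -> has_betti I b -> has_betti (ext_ideal I) b.
Proof.
move=> hI [F bF].
have ext_aug (u : 'rV_(mrk F 0)) c :
    proj c ((u *m map_mx incl (maug F)) 0 0) = (map_mx (proj c) u *m maug F) 0 0.
  by rewrite -map_projM [in RHS]mxE.
have h1 : homogmx (@mdg _ _ _ F 0) (fun=> 0) (map_mx incl (maug F)).
  by move=> k l; rewrite mxE; apply: homogz_incl; apply: maug_homog.
have h2 i : homogmx (@mdg _ _ _ F i.+1) (@mdg _ _ _ F i) (map_mx incl (md F i)).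
  by move=> k l; rewrite mxE; apply: homogz_incl; apply: md_homog.
have h3 : exists u : 'rV_(mrk F 0),
    ext_ideal I (1 - (u *m map_mx incl (maug F)) 0 0).
  have [u Iu] := maug_surj F; exists (map_mx incl u) => c.
  rewrite -map_mxM [fun_of_matrix _ 0 0]mxE -[1](rmorph1 incl) -rmorphB /=.
  by rewrite -[incl _]mulr1 projM mulrC; apply: idealMl.
have h4 (u : 'rV_(mrk F 0)) : ext_ideal I ((u *m map_mx incl (maug F)) 0 0)
    <-> exists w, u = w *m map_mx incl (md F 0).
  split=> [Iu|[w ->] c].
    by apply: exact_incl => // c; apply/maug_exact; rewrite -ext_aug.
  by rewrite ext_aug map_projM; apply/maug_exact; exists (map_mx (proj c) w).
have h5 i (u : 'rV_(mrk F i.+1)) : u *m map_mx incl (md F i) = 0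
    <-> exists w, u = w *m map_mx incl (md F i.+1).
  split=> [u0|[w ->]]; last by rewrite -mulmxA -map_mxM md_md map_mx0 mulmx0.
  apply: exact_incl => // c; apply/md_exact.
  by rewrite -map_projM u0 map_mx0.
have h6 i : redmx (map_mx incl (md F i)) = 0.
  rewrite -(md_min F i) /redmx -map_mx_comp.
  by apply: eq_map_mx => r /=; apply: incl_coeff0.
by exists (MinRes h1 h2 h3 h4 h5 h6).
Qed.

End BaseChange.

(** * Ideals spanned by monomials *)
Section MonomialIdeals.
Local Open Scope ring_scope.
Variables (K : fieldType) (n : nat).
Local Notation S := {mpoly K[n]}.
Implicit Types (D : pred 'X_{1..n}) (c e : 'X_{1..n}) (g : S).

Definition mono_ideal D g := forall c, c \in msupp g -> D c.

Definition up_closed D := forall c e, D c -> D (c + e)%MM.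

Lemma mono_homog_ideal D : up_closed D -> homog_ideal (mono_ideal D).
Proof.
move=> upD; split.
- by move=> c; rewrite msupp0.
- by move=> p q Dp Dq c /msuppD_le; rewrite mem_cat => /orP[/Dp|/Dq].
- move=> a p Dp c /msuppM_le /allpairsP[[c1 c2] /= [_ /Dp Dc2 ->]].
  by rewrite addmC; apply: upD.
- move=> d p Dp c; rewrite mcoeff_msupp mcoeff_hpart.
  by case: ifP => _; rewrite ?eqxx // -mcoeff_msupp => /Dp.
Qed.

Lemma mono_idealX D e : mono_ideal D 'X_[e] <-> D e.
Proof.
split=> [|De c]; first by apply; rewrite msuppX inE.
by rewrite msuppX inE => /eqP->.
Qed.

Lemma mono_idealXM D e g :
  mono_ideal D ('X_[e] * g) <-> mono_ideal (fun c => D (c + e)%MM) g.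
Proof.
rewrite mulrC; split=> Dg c.
  move=> cg; apply: Dg; rewrite (perm_mem (msuppMX _ _)) addmC.
  exact: map_f.
rewrite (perm_mem (msuppMX _ _)) => /mapP[c' /Dg Dc' ->].
by rewrite addmC.
Qed.

Lemma mono_ideal_ind D (P : S -> Prop) :
    P 0 -> (forall p q, P p -> P q -> P (p + q)) ->
    (forall a c, D c -> P (a *: 'X_[c])) ->
  forall g, mono_ideal D g -> P g.
Proof.
move=> P0 PD PX g Dg; rewrite [g]mpolyE big_seq.
by elim/big_ind: _ => // c /Dg; apply: PX.
Qed.

Lemma cone_mono_ideal D e1 e2 g : up_closed D ->
  cone_ideal (mono_ideal D) 'X_[e1] 'X_[e2] g <->
  mono_ideal (fun c => D c || (e1 + e2 <= c)%MM) g.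
Proof.
move=> upD; have hD := mono_homog_ideal upD.
have hD' : homog_ideal (mono_ideal (fun c => D c || (e1 + e2 <= c)%MM)).
  apply: mono_homog_ideal => c e /orP[/upD-> //|ec].
  by apply/orP; right; apply: lepm_trans ec (lem_addr _ _).
rewrite /cone_ideal; split=> [[s Ds]|].
  rewrite -[g](subrK ('X_[e1] * 'X_[e2] * s)); apply: (idealD hD').
    by move=> c /Ds ->.
  rewrite mulrC -mpolyXD; apply: (idealMl hD'); apply/mono_idealX.
  by rewrite lepm_refl orbT.
move: g; apply: mono_ideal_ind => [|p q [s Ds] [t Dt]|a c /orP[Dc|ec]].
- by exists 0; rewrite mulr0 subr0; apply: (ideal0 hD).
- by exists (s + t); rewrite mulrDr opprD addrACA; apply: (idealD hD).
- exists 0; rewrite mulr0 subr0 -mul_mpolyC; apply: (idealMl hD).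
  exact/mono_idealX.
- exists (a *: 'X_[c - (e1 + e2)]); rewrite -mpolyXD -scalerAr -mpolyXD addmC.
  by rewrite submK // subrr; apply: (ideal0 hD).
Qed.

(** The two hypotheses on D say that the monomial e1 is regular modulo the ideal
of D and that D' describes the colon by e2; on exponents they involve
no polynomials at all. *)
Lemma mono_cone_has_betti D D' e1 e2 b b' :
    up_closed D -> e1 != 0%MM ->
    (forall c, D (c + e1)%MM -> D c) -> (forall c, D (c + e2)%MM = D' c) ->
    has_betti (@mono_ideal D) b -> has_betti (@mono_ideal D') b' ->
  has_betti (@mono_ideal (fun c => D c || (e1 + e2 <= c)%MM))
    (fun i d => b i d + shift_table b' (mdeg e1 + mdeg e2)%N i d)%N.
Proof.
move=> upD e1_neq0 reg colon hb hb'.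
apply: has_betti_iff (fun g => cone_mono_ideal e1 e2 g upD) _.
rewrite PoszD; apply: cone_has_betti hb hb'.
- exact: mono_homog_ideal.
- exact: homogz_mpolyX.
- by rewrite mcoeffX (negbTE e1_neq0).
- exact: homogz_mpolyX.
- by move=> g /mono_idealXM Dg c /Dg /reg.
- by move=> g; apply: iff_trans (mono_idealXM _ _ _) _;
    split=> Dg c /Dg; rewrite colon.
Qed.

(** The effect on Betti numbers of tensoring with the Koszul complex of one
variable. *)
Definition koszul_step (b : nat -> int -> nat) (i : nat) (d : int) :=
  (b i d + shift_table b 1 i d)%N.

(** Each variable is regular modulo D and the previous ones, and the cone of its
multiplication on a resolution is minimal. *)
Lemma koszul_has_betti D (xs : seq 'I_n) b :
    up_closed D -> uniq xs ->
    (forall x c, x \in xs -> D (c + U_(x))%MM -> D c) ->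
    has_betti (@mono_ideal D) b ->
  has_betti (@mono_ideal (fun c => D c || has (fun x => c x != 0%N) xs))
    (iter (size xs) koszul_step b).
Proof.
move=> upD; elim: xs => [|x xs IH] /=.
  by move=> _ _; apply: has_betti_iff => g; split=> Dg c /Dg; rewrite orbF.
case/andP=> xxs uxs reg hb.
have {}IH := IH uxs (fun y c yxs => reg y c (mem_behead (s := x :: xs) yxs)) hb.
set D1 : pred 'X_{1..n} := fun c => _ || has _ xs in IH.
have upD1 : up_closed D1.
  move=> c e /orP[/upD De|]; rewrite /D1 ?De // => /hasP[y yxs cy].
  apply/orP; right; apply/hasP; exists y => //.
  by rewrite mnmDE addn_eq0 (negbTE cy).
have reg1 c : D1 (c + U_(x))%MM -> D1 c.
  case/orP=> [/reg Dc|/hasP[y yxs]].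
    by rewrite /D1 Dc // inE eqxx.
  rewrite mnmDE mnm1E; have [xy|_] := eqVneq x y.
    by rewrite xy yxs in xxs.
  by rewrite addn0 => cy; apply/orP; right; apply/hasP; exists y.
have x0 : U_(x)%MM != 0%MM :> 'X_{1..n} by rewrite mnm1_eq0.
have colon1 c : D1 (c + 0)%MM = D1 c by rewrite addm0.
have := mono_cone_has_betti upD1 x0 reg1 colon1 IH IH.
rewrite mdeg0 mdeg1 addm0; apply: has_betti_iff => g.
by split=> Dg c /Dg; rewrite lep1mP /D1 -orbA (orbC (has _ _)).
Qed.

End MonomialIdeals.

Section BaseChangeMonomial.
Local Open Scope ring_scope.
Variables (K : fieldType) (m n : nat) (s : 'I_m -> 'I_n).
Hypothesis s_inj : injective s.

Definition mrestr (c : 'X_{1..n}) : 'X_{1..m} := [multinom c (s i) | i < m].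

Definition mpush (c : 'X_{1..m}) : 'X_{1..n} := (\sum_i U_(s i) *+ c i)%MM.

Lemma mpushE c i : mpush c (s i) = c i.
Proof.
rewrite /mpush mnm_sumE (bigD1 i) //= mulmnE mnm1E eqxx mul1n big1 ?addn0 //.
by move=> j ji; rewrite mulmnE mnm1E (inj_eq s_inj) (negbTE ji).
Qed.

Lemma mpush_restr_le c : (mpush (mrestr c) <= c)%MM.
Proof.
apply/mnm_lepP => j; have [i sij|sj] := pickP [pred i | s i == j].
  by rewrite -(eqP sij) mpushE mnmE.
rewrite /mpush mnm_sumE big1 // => i _; rewrite mulmnE mnm1E.
by have /= -> := sj i.
Qed.

Lemma incl_mpolyX c : @incl K m n s 'X_[c] = 'X_[mpush c].
Proof.
rewrite /incl mmapX /mmap1 /mpush.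
rewrite (big_morph (@mpolyX n K) (@mpolyXD n K) (@mpolyX0 n K)).
by apply: eq_bigr => i _; rewrite mpolyXn.
Qed.

(** Both sides are generated by the monomials of D, read in S. *)
Lemma ext_mono_ideal (D : pred 'X_{1..m}) g : up_closed D ->
  ext_ideal s (@mono_ideal K m D) g <-> mono_ideal (fun c => D (mrestr c)) g.
Proof.
move=> upD; have hD := @mono_homog_ideal K _ _ upD.
have restrD c e : mrestr (c + e) = (mrestr c + mrestr e)%MM.
  by apply/mnmP => i; rewrite !(mnmE, mnmDE).
have upD' : up_closed (fun c => D (mrestr c)).
  by move=> c e Dc; rewrite restrD; apply: upD.
have hD' := @mono_homog_ideal K _ _ upD'.
split=> [Dg|].
  rewrite [g](sum_proj (leqnn (msize (separate s g)))).
  apply: (ideal_sum _ hD') => c _.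
  apply: (idealMl hD'); move: (proj s c g) (Dg c); apply: mono_ideal_ind.
  - by rewrite raddf0; apply: (ideal0 hD').
  - by move=> p q Dp Dq; rewrite raddfD; apply: (idealD hD').
  move=> a e De; rewrite -mul_mpolyC rmorphM /=; apply: (idealMl hD').
  rewrite incl_mpolyX; apply/mono_idealX.
  by rewrite (_ : mrestr _ = e) //; apply/mnmP => i; rewrite mnmE mpushE.
move: g; apply: mono_ideal_ind => [|p q Dp Dq|a c Dc] e.
- by rewrite raddf0; apply: (ideal0 hD).
- by rewrite raddfD; apply: (idealD hD (Dp e) (Dq e)).
rewrite -(submK (mpush_restr_le c)) addmC mpolyXD -incl_mpolyX scalerAr.
rewrite (projM s_inj) mulrC; apply: (idealMl hD); exact/mono_idealX.
Qed.

End BaseChangeMonomial.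

(** * Edge ideals and the recursion at a leaf *)
Section EdgeIdeals.
Local Open Scope ring_scope.
Variable K : fieldType.

Definition edge_mon (T : finType) (E : rel T) : pred 'X_{1..#|T|} :=
  fun c => [exists x, exists y,
    [&& E x y, c (enum_rank x) != 0%N & c (enum_rank y) != 0%N]].

Lemma edge_monP (T : finType) (E : rel T) (c : 'X_{1..#|T|}) :
  reflect (exists x y,
    [/\ E x y, c (enum_rank x) != 0%N & c (enum_rank y) != 0%N])
    (edge_mon E c).
Proof.
apply: (iffP existsP) => [[x /existsP[y /and3P Exy]]|[x [y /and3P Exy]]].
  by exists x, y.
by exists x; apply/existsP; exists y.
Qed.

Lemma edge_mon_up (T : finType) (E : rel T) : up_closed (@edge_mon T E).
Proof.
move=> c e /edge_monP[x [y [Exy cx cy]]]; apply/edge_monP; exists x, y.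
by rewrite !mnmDE !addn_eq0 (negbTE cx) (negbTE cy).
Qed.

Lemma edge_idealD (G : sgraph) (p q : {mpoly K[#|G|]}) :
  edge_ideal p -> edge_ideal q -> edge_ideal (p + q).
Proof.
move=> [f ->] [g ->]; exists (fun x y => f x y + g x y).
rewrite -big_split; apply: eq_bigr => x _.
by rewrite -big_split; apply: eq_bigr => y _; rewrite /= mulrDl.
Qed.

Lemma edge_ideal_mono (G : sgraph) (p : {mpoly K[#|G|]}) :
  edge_ideal p <-> mono_ideal (edge_mon (@adj G)) p.
Proof.
split=> [[g ->]|].
  have hI := @mono_homog_ideal K _ _ (edge_mon_up (E := @adj G)).
  apply: (ideal_sum _ hI) => x _; apply: (ideal_sum _ hI) => y xy.
  apply: (idealMl hI); rewrite /vvar -mpolyXD; apply/mono_idealX/edge_monP.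
  by exists x, y; rewrite !mnmDE !mnm1E !eqxx addn_eq0 addn1.
move: p; apply: mono_ideal_ind => [|p q|a c /edge_monP[x [y [xy cx cy]]]].
- exists (fun _ _ => 0); rewrite big1 // => x _.
  by rewrite big1 // => y _; rewrite mul0r.
- exact: edge_idealD.
set u := (U_(enum_rank x) + U_(enum_rank y))%MM.
exists (fun x' y' => if (x', y') == (x, y) then a *: 'X_[c - u] else 0).
rewrite (bigD1 x) //= [X in _ + X]big1 ?addr0; last first.
  move=> x' x'x; rewrite big1 // => y' _.
  by rewrite xpair_eqE (negbTE x'x) mul0r.
rewrite (bigD1 y) //= eqxx big1 ?addr0; last first.
  by move=> y' /andP[_ y'y]; rewrite xpair_eqE (negbTE y'y) andbF mul0r.
rewrite /vvar -mpolyXD -scalerAl -mpolyXD submK //.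
apply/mnm_lepP => i; rewrite mnmDE !mnm1E.
have [<-|xi] := eqVneq (enum_rank x) i; last first.
  by have [<-|//] := eqVneq (enum_rank y) i; rewrite lt0n.
rewrite (inj_eq enum_rank_inj).
by have [yx|] := eqVneq y x; [rewrite yx adj_irrefl in xy | rewrite lt0n].
Qed.

Lemma betti_tableP (G : sgraph) b :
  betti_table K G b <-> has_betti (@mono_ideal K _ (edge_mon (@adj G))) b.
Proof.
apply: iff_trans (_ : has_betti (@edge_ideal K G) b <-> _); last first.
  by split; apply: has_betti_iff => p; [|apply: iff_sym]; apply: edge_ideal_mono.
split=> [[F bF]|[F bF]].
  have h1 : homogmx (@gdeg _ _ F 0) (fun=> 0) (aug F).
    by move=> k l c; rewrite subr0 ord1 => /aug_homog->.
  have h2 i : homogmx (@gdeg _ _ F i.+1) (@gdeg _ _ F i) (bdry F i).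
    by move=> k l c /bdry_homog ->; rewrite addrC addKr.
  have h3 i : redmx (bdry F i) = 0.
    by apply/matrixP => k l; rewrite !mxE bdry_min.
  by exists (MinRes h1 h2 (aug_surj F) (@aug_exact _ _ F) (@bdry_exact _ _ F) h3).
have h1 (k : 'I_(mrk F 0)) m : m \in msupp (maug F k 0) -> mdg k = (mdeg m)%:Z.
  by move=> /maug_homog; rewrite subr0.
have h2 i (k : 'I_(mrk F i.+1)) (l : 'I_(mrk F i)) m :
    m \in msupp (md F i k l) -> mdg k = mdg l + (mdeg m)%:Z.
  by move=> /md_homog ->; rewrite addrC subrK.
have h3 i (k : 'I_(mrk F i.+1)) (l : 'I_(mrk F i)) : (md F i k l)@_0%MM = 0.
  by have /matrixP/(_ k l) := md_min F i; rewrite !mxE.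
by exists (MinResolution h1 h2 (maug_surj F) (@maug_exact _ _ _ F)
  (@md_exact _ _ _ F) h3).
Qed.

Lemma betti_table_betti (G : sgraph) b (i : nat) (d : int) :
  betti_table K G b -> betti K G i d = b i d.
Proof.
move=> hb; have /betti_tableP hG : betti_table K G (epsilon
    (inhabits (fun _ _ => 0%N)) (@betti_table K G)).
  by apply: epsilon_spec; exists b.
apply: has_betti_uniq hG _; first exact/mono_homog_ideal/edge_mon_up.
exact/betti_tableP.
Qed.

(** The edges of the graph without A, as a relation on all of G: this keeps all
the ideals in the polynomial ring of G. *)
Definition avoiding (G : sgraph) (A : {set G}) : rel G :=
  [rel x y | [&& adj x y, x \notin A & y \notin A]].

Lemma delete_has_betti (G : sgraph) (A : {set G}) b :
  betti_table K (delete A) b ->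
  has_betti (@mono_ideal K _ (edge_mon (avoiding A))) b.
Proof.
move=> /betti_tableP hb.
pose s (i : 'I_#|delete A|) := enum_rank (val (enum_val i : delete A)).
have s_inj : injective s by move=> i j /enum_rank_inj/val_inj/enum_val_inj.
have upD := edge_mon_up (E := @adj (delete A)).
have hI := @mono_homog_ideal K _ _ upD.
apply: has_betti_iff (ext_has_betti s_inj hI hb) => g.
apply: iff_trans (ext_mono_ideal s_inj g upD) _.
suff DE c : edge_mon (@adj (delete A)) (mrestr s c) = edge_mon (avoiding A) c.
  by split=> Dg c /Dg; rewrite DE.
apply/edge_monP/edge_monP => [[x [y []]]|[x [y [/and3P[xy xA yA] cx cy]]]].
  rewrite !mnmE /s !enum_rankK => xy cx cy; exists (val x), (val y).
  by split=> //; apply/and3P; split; [| exact: (valP x) | exact: (valP y)].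
exists (Sub x xA), (Sub y yA).
by rewrite !mnmE /s !enum_rankK.
Qed.

(** The variable u is regular modulo the edges that avoid u.  A monomial times v
contains such an edge iff the monomial contains a neighbour of v other than u,
or an edge that avoids v and N(v), because an edge that meets v or N(v) has an
end in N(v).  So the Koszul steps resolve this colon ideal, and u v is the
only generator to add, being the only edge that contains u. *)
Lemma leaf_betti_table (G : sgraph) (u v : G) b' b'' :
    neighbours u = [set v] ->
    betti_table K (delete [set u]) b' ->
    betti_table K (delete (v |: neighbours v)) b'' ->
  betti_table K G (fun i d => b' i d +
    shift_table (iter (degree v).-1 koszul_step b'') 2 i d)%N.
Proof.
move=> Nu /delete_has_betti hb' /delete_has_betti hb''; apply/betti_tableP.
have uadj x : adj u x = (x == v) by move/setP/(_ x): Nu; rewrite !inE.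
have adju x : adj x u = (x == v) by rewrite adj_sym uadj.
have uv : u != v.
  by apply/eqP => uv; have := uadj v; rewrite uv adj_irrefl eqxx.
pose xs := [seq enum_rank x | x in neighbours v :\ u].
have xsE x : (enum_rank x \in xs) = (x != u) && adj v x.
  by rewrite mem_map ?mem_enum ?inE //; exact: enum_rank_inj.
have size_xs : size xs = (degree v).-1.
  rewrite size_map -cardE /degree (cardsD1 u (neighbours v)) inE.
  by rewrite adj_sym uadj eqxx.
have uniq_xs : uniq xs.
  by rewrite map_inj_uniq ?enum_uniq //; exact: enum_rank_inj.
have pos_addU (c : 'X_{1..#|G|}) x y :
    ((c + U_(enum_rank x))%MM (enum_rank y) != 0%N) =
    (c (enum_rank y) != 0%N) || (x == y).
  by rewrite mnmDE mnm1E (inj_eq enum_rank_inj) addn_eq0 negb_and eqb0 negbK.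
have reg'' x c : x \in xs ->
    edge_mon (avoiding (v |: neighbours v)) (c + U_(x))%MM ->
    edge_mon (avoiding (v |: neighbours v)) c.
  rewrite -[x]enum_valK xsE => /andP[_ vx].
  move=> /edge_monP[y [z [yz]]]; rewrite !pos_addU => cy cz.
  apply/edge_monP; exists y, z; split=> //.
    case/orP: cy => // /eqP xy; move: yz; rewrite -xy /avoiding /=.
    by rewrite !inE vx orbT andbF.
  case/orP: cz => // /eqP xz; move: yz; rewrite -xz /avoiding /=.
  by rewrite !inE vx orbT !andbF.
have := koszul_has_betti (@edge_mon_up _ _) uniq_xs reg'' hb''.
rewrite size_xs => hJ.
have reg' c : edge_mon (avoiding [set u]) (c + U_(enum_rank u))%MM ->
    edge_mon (avoiding [set u]) c.
  move=> /edge_monP[y [z [/and3P[yz]]]]; rewrite !pos_addU !inE => yu zu.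
  rewrite ![u == _]eq_sym (negbTE yu) (negbTE zu) !orbF => cy cz.
  by apply/edge_monP; exists y, z; split=> //; apply/and3P; rewrite !inE.
have u0 : U_(enum_rank u)%MM != 0%MM :> 'X_{1..#|G|} by rewrite mnm1_eq0.
have colon c : edge_mon (avoiding [set u]) (c + U_(enum_rank v))%MM =
    edge_mon (avoiding (v |: neighbours v)) c || has (fun x => c x != 0%N) xs.
  apply/edge_monP/orP => [[x [y [/and3P[xy]]]]|[/edge_monP|/hasP]].
  - rewrite !pos_addU !inE => xu yu cx cy.
    have [cN|cN] := boolP (has _ _); [by right|left].
    have notN z : z != u -> c (enum_rank z) != 0%N -> ~~ adj v z.
      move=> zu cz; apply: contra cN => vz; apply/hasP.
      exists (enum_rank z) => //.
      by rewrite xsE zu.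
    have xv : x != v.
      apply/eqP => xv; rewrite xv in xy cx; case/orP: cy => [cy|/eqP vy].
        by have := notN y yu cy; rewrite xy.
      by rewrite vy adj_irrefl in xy.
    have yv : y != v.
      apply/eqP => yv; rewrite yv in xy cy; case/orP: cx => [cx|/eqP vx].
        by have := notN x xu cx; rewrite adj_sym xy.
      by rewrite vx adj_irrefl in xy.
    rewrite ![v == _]eq_sym (negbTE xv) (negbTE yv) !orbF in cx cy.
    apply/edge_monP; exists x, y; split=> //; apply/and3P.
    by rewrite !inE (negbTE xv) (negbTE yv) /= !notN.
  - move=> [x [y [/and3P[xy]]]]; rewrite !inE !negb_or.
    move=> /andP[xv vx] /andP[yv vy] cx cy; exists x, y.
    rewrite !pos_addU cx cy; split=> //; apply/and3P; split=> //.
      by rewrite inE; apply: contraNneq vx => ->; rewrite adju.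
    by rewrite inE; apply: contraNneq vy => ->; rewrite adju.
  - move=> [x]; rewrite -[x]enum_valK xsE => /andP[xu vx] cx.
    exists v, (enum_val x); rewrite !pos_addU cx eqxx orbT; split=> //.
    by apply/and3P; rewrite !inE eq_sym uv.
have := mono_cone_has_betti (@edge_mon_up _ _) u0 reg' colon hb' hJ.
rewrite !mdeg1; apply: has_betti_iff => g.
suff DE c : edge_mon (avoiding [set u]) c
    || (U_(enum_rank u) + U_(enum_rank v) <= c)%MM = edge_mon (@adj G) c.
  by split=> Dg c /Dg; rewrite DE.
apply/orP/edge_monP => [[/edge_monP|/mnm_lepP uvc]|].
- by move=> [x [y [/and3P[xy _ _] cx cy]]]; exists x, y.
- exists u, v; rewrite uadj eqxx; split=> //; rewrite -lt0n.
    apply: leq_trans (uvc (enum_rank u)); rewrite mnmDE mnm1E eqxx.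
    by [].
  apply: leq_trans (uvc (enum_rank v)).
  by rewrite mnmDE !mnm1E eqxx addn1.
- move=> [x [y [xy cx cy]]].
  have le_uvc : c (enum_rank u) != 0%N -> c (enum_rank v) != 0%N ->
      (U_(enum_rank u) + U_(enum_rank v) <= c)%MM.
    move=> cu cv; apply/mnm_lepP => i; rewrite mnmDE !mnm1E.
    have [<-|_] := eqVneq (enum_rank u) i; last first.
      by have [<-|//] := eqVneq (enum_rank v) i; rewrite lt0n.
    by rewrite (inj_eq enum_rank_inj) eq_sym (negbTE uv) lt0n.
  have [xu|xu] := eqVneq x u.
    right; apply: le_uvc; first by rewrite -xu.
    by rewrite xu uadj in xy; rewrite -(eqP xy).
  have [yu|yu] := eqVneq y u.
    right; apply: le_uvc; first by rewrite -yu.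
    by rewrite yu adju in xy; rewrite -(eqP xy).
  left; apply/edge_monP; exists x, y; split=> //.
  by apply/and3P; rewrite !inE.
Qed.

End EdgeIdeals.

(** * Forests *)
Section Forests.

Lemma forest_delete (G : sgraph) (A : {set G}) : forest G -> forest (delete A).
Proof.
move=> hG c c3 /andP[cc uc]; apply: (hG (map val c)); first by rewrite size_map.
apply/andP; split; last by rewrite (map_inj_uniq val_inj).
by case: c cc {uc c3} => //= x c; rewrite -map_rcons path_map.
Qed.

Lemma card_delete (G : sgraph) (A : {set G}) x :
  x \in A -> (#|delete A| < #|G|)%N.
Proof.
move=> xA; rewrite card_sig; apply: proper_card; apply/properP.
by split; [exact/subsetP | exists x; rewrite ?inE ?xA].
Qed.

(** The first vertex x of a longest path has no neighbour other than the second
one: a neighbour off the path would extend it, one on it would close a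
cycle. *)
Lemma forest_leaf (G : sgraph) (x y : G) :
  forest G -> adj x y -> exists u v : G, neighbours u = [set v].
Proof.
move=> hG xy.
suff leaf k : forall x y p, path (@adj G) x (y :: p) -> uniq [:: x, y & p] ->
    #|G| - size [:: x, y & p] < k -> exists u v : G, neighbours u = [set v].
  apply: (leaf #|G|.+1 x y [::]); rewrite ?ltnS ?leq_subr //= ?xy // inE andbT.
  by apply: contraTneq xy => ->; rewrite adj_irrefl.
elim: k => // k IH {xy}x {}y p xyp uxyp szG.
have [Nx|] := boolP (neighbours x \subset [set y]).
  exists x, y; apply/eqP; rewrite eqEsubset Nx sub1set inE.
  by case/andP: xyp.
case/subsetPn => z; rewrite !inE => xz zy.
have zx : z != x by apply: contraTneq xz => ->; rewrite adj_irrefl.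
have zp : z \notin p.
  apply/negP => /splitPr pE; case: pE xyp uxyp {szG} => p1 p2.
  rewrite -cat_rcons -!cat_cons cat_path cat_uniq.
  move=> /andP[pth _] /and3P[u _ _].
  (* x, y, p1 and the second neighbour z of x close up to a cycle. *)
  apply: (hG [:: x, y & rcons p1 z]); first by rewrite /= size_rcons.
  rewrite /ucycle /cycle u andbT rcons_path pth /= last_rcons.
  by rewrite adj_sym.
have uz : uniq [:: z, x, y & p] by rewrite cons_uniq uxyp !inE !negb_or zx zy zp.
apply: (IH z x (y :: p)) => //; first by rewrite /= adj_sym xz.
have := max_card (mem [:: z, x, y & p]); rewrite (card_uniqP uz) => szz.
by apply: leq_trans (ltnSE szG); apply: ltn_sub2l.
Qed.

End Forests.

Section ForestResolutions.
Local Open Scope ring_scope.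
Variable K : fieldType.

Lemma zero_ideal_has_betti n (I : {mpoly K[n]} -> Prop) :
  (forall g, I g <-> g = 0) -> exists b, has_betti I b.
Proof.
move=> I0; pose r i : nat := if i is 0 then 1%N else 0%N.
pose dg i (k : 'I_(r i)) : int := 0.
pose M i : 'M[{mpoly K[n]}]_(r i.+1, r i) := 0.
have h1 : homogmx (@dg 0%N) (fun=> 0) (1%:M : 'cV[{mpoly K[n]}]_1).
  by move=> k l c; rewrite mxE !ord1 msupp1 inE => /eqP->; rewrite mdeg0.
have h2 i : homogmx (@dg i.+1) (@dg i) (M i) by case.
have h3 : exists u : 'rV_1, I (1 - (u *m 1%:M) 0 0).
  by exists 1%:M; apply/I0; rewrite mulmx1 mxE subrr.
have h4 (u : 'rV_1) : I ((u *m 1%:M) 0 0) <-> exists w, u = w *m M 0%N.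
  rewrite mulmx1; split=> [/I0 u0|[w ->]]; last by apply/I0; rewrite mulmx0 mxE.
  by exists 0; rewrite mul0mx [u]mx11_scalar u0 raddf0.
have h5 i (u : 'rV_(r i.+1)) : u *m M i = 0 <-> exists w, u = w *m M i.+1.
  by split=> _; [exists 0; rewrite [u]thinmx0 mul0mx | rewrite mulmx0].
have h6 i : redmx (M i) = 0 by rewrite /redmx map_mx0.
by exists (mres_betti (MinRes h1 h2 h3 h4 h5 h6)), (MinRes h1 h2 h3 h4 h5 h6).
Qed.

Lemma forest_betti_table (G : sgraph) : forest G -> exists b, betti_table K G b.
Proof.
have [n] := ubnP #|G|; elim: n G => // n IH G leGn hG.
have [/existsP[x /existsP[y xy]]|/existsPn noedge] :=
  boolP [exists x : G, exists y : G, adj x y]; last first.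
  have [|b hb] := @zero_ideal_has_betti _ (mono_ideal (edge_mon (@adj G))).
    move=> g; split=> [Ig|-> c]; last by rewrite msupp0.
    apply/eqP; rewrite -msupp_eq0; case gE: (msupp g) => [//|c r].
    have /Ig/edge_monP[x [y [xy _ _]]] : c \in msupp g by rewrite gE mem_head.
    by have /existsPn/(_ y) := noedge x; rewrite xy.
  by exists b; apply/betti_tableP.
have [u [v Nu]] := forest_leaf hG xy.
have [b' hb'] : exists b, betti_table K (delete [set u]) b.
  apply: IH (forest_delete hG); apply: leq_trans (ltnSE leGn).
  by apply: (card_delete (x := u)); rewrite inE.
have [b'' hb''] : exists b, betti_table K (delete (v |: neighbours v)) b.
  apply: IH (forest_delete hG); apply: leq_trans (ltnSE leGn).
  by apply: (card_delete (x := v)); rewrite setU11.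
exact: ex_intro _ _ (leaf_betti_table Nu hb' hb'').
Qed.

End ForestResolutions.

(** * Binomial coefficients *)
Section BinomialSums.
Local Open Scope ring_scope.

(** Tables are extended by zero to the negative homological degrees that occur
in binomial sums. *)
Definition int_table (b : nat -> int -> nat) (i d : int) : nat :=
  if i is Posz p then b p d else 0%N.

Lemma int_table_shift b c i d :
  int_table (shift_table b c) i d = int_table b (i - 1) (d - c).
Proof.
case: i => [[|p]|p] //.
by rewrite (_ : p.+1%:Z - 1 = p) // intS addrC addKr.
Qed.

(** Pascal's rule. *)
Lemma int_table_koszul k b i d :
  int_table (iter k koszul_step b) i d =
  (\sum_(0 <= j < k.+1) 'C(k, j) * int_table b (i - j%:Z) (d - j%:Z))%N.
Proof.
elim: k i d => [|k IH] i d; first by rewrite big_nat1 !subr0 mul1n.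
have -> : int_table (iter k.+1 koszul_step b) i d =
    (int_table (iter k koszul_step b) i d +
     int_table (shift_table (iter k koszul_step b) 1) i d)%N by case: i.
rewrite int_table_shift !IH [RHS]big_nat_recl // bin0.
under [in RHS]eq_bigr => j _ do rewrite binS mulnDl.
rewrite big_split /= addnA; congr (_ + _)%N.
  rewrite [LHS]big_nat_recl // bin0 [in RHS]big_nat_recr //=.
  by rewrite bin_small // mul0n addn0.
apply: eq_bigr => j _; rewrite -[j.+1]add1n PoszD !opprD !addrA.
by [].
Qed.

End BinomialSums.

Lemma betti_int_table (K : fieldType) (G : sgraph) b (i d : int) :
  betti_table K G b -> betti K G i d = int_table b i d.
Proof. by case: i => // i; apply: betti_table_betti. Qed.

Theorem theorem4p6 (K : fieldType) (T : sgraph) (hT : forest T)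
  (v : T) (n : nat) (hn : 1 < n) (w : 'I_n -> T) (w_inj : injective w)
  (hw : neighbours v = [set w k | k : 'I_n])
  (hdeg : forall k : 'I_n, k.+1 < n -> degree (w k) = 1)
  (i d : int) :
  let T' := delete [set w (Ordinal (ltnW hn))] in
  let T'' := delete (v |: [set w k | k : 'I_n]) in
  betti K T i d =
    betti K T' i d +
    \sum_(0 <= j < n)
      'C(n.-1, j) * betti K T'' (i - j.+1%:Z)%R (d - j.+2%:Z)%R.
Proof.
move=> T' T''; rewrite {}/T' {}/T''; set w1 := w _.
have Nw1 : neighbours w1 = [set v].
  apply/eqP; rewrite eq_sym eqEcard cards1 sub1set inE adj_sym.
  rewrite -/(degree w1) hdeg // andbT.
  have : w1 \in neighbours v by rewrite hw imset_f.
  by rewrite inE.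
have degv : degree v = n by rewrite /degree hw card_imset // card_ord.
have [b' hb'] := forest_betti_table K (forest_delete (A := [set w1]) hT).
have [b'' hb''] :=
  forest_betti_table K (forest_delete (A := v |: neighbours v) hT).
have hb := leaf_betti_table Nw1 hb' hb''.
rewrite (betti_int_table _ _ hb) (betti_int_table _ _ hb') -hw.
under eq_bigr => j _ do rewrite (betti_int_table _ _ hb'').
rewrite degv.
transitivity (int_table b' i d +
    int_table (shift_table (iter n.-1 koszul_step b'') 2) i d).
  by case: i.
rewrite int_table_shift int_table_koszul prednK ?(ltnW hn) //; congr (_ + _).
apply: eq_bigr => j _; rewrite -addn1 -[j.+2]addn2 !PoszD.
by congr (_ * int_table _ _ _); ring.
Qed.
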